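(* Let $m\ge n\ge1$ and $K\ge 0$, and let $G_0,\dots,G_K\in\mathbb{R}^{m\times n}$ be nonzero matrices with orthogonal polar factors $U_0,\dots,U_K$. For each $k$ run the quintic Newton–Schulz iteration $$\widetilde U_{k,0}=\frac{G_k}{\|G_k\|_F},\qquad\widetilde U_{k,j+1}=a\,\widetilde U_{k,j}+b\,\widetilde U_{k,j}\widetilde U_{k,j}^\top\widetilde U_{k,j}+c\,\widetilde U_{k,j}(\widetilde U_{k,j}^\top\widetilde U_{k,j})^2$$ with $(a,b,c)=(15/8,-5/4,3/8)$ for $T$ inner steps and set $\widetilde U_k=\widetilde U_{k,T}$. Let $e_{k,j}=\|\widetilde U_{k,j}^\top\widetilde U_{k,j}-I_n\|_S$, $e_0=\max_{0\le k\le K}e_{k,0}$, $\varepsilon_{\max}(T)=\max_{0\le k\le K}\|\widetilde U_k-U_k\|_S$ and $\delta_{\max}(T)=\max_{0\le k\le K}\|\widetilde U_k^\top\widetilde U_k-I_n\|_S$. (1) There are constants $C_\varepsilon,C_\delta>0$, independent of $k$ and $T$, with $$\varepsilon_{\max}(T)\le C_\varepsilon\,e_0^{3^T}\quad\text{and}\quad\delta_{\max}(T)\le C_\delta\,e_0^{3^T}.$$ (2) Let $f\colon\mathbb{R}^{m\times n}\to\mathbb{R}\cup\{+\infty\}$ be $L$-Lipschitz smooth and $\mu$-Polyak–Łojasiewicz, $L,\mu\in(0,\infty)$, with $f^\star=\min f$ and $\kappa_H=L/\mu$. For every $e_0\in(0,1)$ there are constants $C>0$ and $\eta_0\in(0,1)$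 such that for every $\eta\in(0,\eta_0]$ and every integer $$T\ge\Bigl\lceil C\log\Bigl(\frac{\log\eta}{\log e_0}\Bigr)\Bigr\rceil$$ the following holds: if realized PolarGrad $X_{k+1}=X_k-\gamma\langle\widetilde U_k,G_k\rangle_F\widetilde U_k$ is run with $G_k=\nabla f(X_k)$, with $\widetilde U_k=\widetilde U_{k,T}$ obtained from $T$ steps of the quintic Newton–Schulz iteration $\widetilde U_{k,0}=G_k/\|G_k\|_F$, $\widetilde U_{k,j+1}=\frac{15}{8}\widetilde U_{k,j}-\frac54\widetilde U_{k,j}\widetilde U_{k,j}^\top\widetilde U_{k,j}+\frac38\widetilde U_{k,j}(\widetilde U_{k,j}^\top\widetilde U_{k,j})^2$, with $\gamma=1/(Lr_{\max}(1+\delta_{\max}(T)))$, $r_{\max}=\max_{0\le k\le K}\mathrm{rank}(G_k)$, and if the value of $\max_{0\le k\le K}e_{k,0}$ along the run equals $e_0$, then its rate is within a factor $1-\eta$ of the exact rate $1/(r_{\max}\kappa_H)$, i.e. for $0\le k\le K$ $$f(X_{k+1})-f^\star\le\Bigl(1-\frac{1-\eta}{r_{\max}\kappa_H}\Bigr)\bigl(f(X_k)-f^\star\bigr).$$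
   Context: $\|\cdot\|_F$ is the Frobenius norm, $\|\cdot\|_S$ the spectral norm and $\langle A,B\rangle_F=\mathrm{tr}(A^\top B)$. The orthogonal polar factor of $G$ of rank $r$ with compact singular value decomposition $\sum_{i=1}^r\sigma_iu_iv_i^\top$ ($\sigma_i>0$) is $U=\sum_{i=1}^ru_iv_i^\top$. $f$ is $L$-Lipschitz smooth if it is finite and differentiable everywhere and $\|\nabla f(X)-\nabla f(Y)\|_F\le L\|X-Y\|_F$ for all $X,Y$. $f$ is $\mu$-Polyak–Łojasiewicz if $\|\nabla f(X)\|_F^2\ge2\mu(f(X)-f^\star)$ for all $X$, where $f^\star=\min f$ (assumed attained). *)

(* Defs.v *)
From HB Require Import structures.
From mathcomp Require Import all_boot all_order all_algebra.
From mathcomp Require Import all_classical all_reals all_analysis.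

Set Implicit Arguments.
Unset Strict Implicit.
Unset Printing Implicit Defensive.

Import Order.TTheory GRing.Theory Num.Theory.
Import numFieldNormedType.Exports.

Local Open Scope classical_set_scope.
Local Open Scope ring_scope.

Section MatrixNorms.
Context {R : realType}.

(* The library norm on matrices is the max-entry norm, hence the separate
   Frobenius and spectral norms below. *)
Definition frob_inner m n (A B : 'M[R]_(m, n)) : R := \tr (A^T *m B).

Definition frob_norm m n (A : 'M[R]_(m, n)) : R := Num.sqrt (frob_inner A A).

(* The operator norm induced by the Euclidean norms; on a column vector,
   [frob_norm] is the Euclidean norm. *)
Definition spectral_norm m n (A : 'M[R]_(m, n)) : R :=
  sup [set frob_norm (A *m x) | x in [set x : 'cV[R]_n | frob_norm x <= 1]].

(* [P *m diag_mx s *m Q^T] is a compact singular value decomposition of [G]: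
   the columns of [P] and [Q] are the left and right singular vectors. The
   factor [U] does not depend on which decomposition is chosen. *)
Definition is_polar_factor m n (G U : 'M[R]_(m, n)) : Prop :=
  exists (P : 'M[R]_(m, \rank G)) (s : 'rV[R]_(\rank G))
         (Q : 'M[R]_(n, \rank G)),
    [/\ P^T *m P = 1%:M, Q^T *m Q = 1%:M, (forall i, 0 < s 0 i),
        G = P *m diag_mx s *m Q^T & U = P *m Q^T].

End MatrixNorms.

Section NewtonSchulz.
Context {R : realType}.

Definition ns_step (a b c : R) m n (V : 'M[R]_(m, n)) : 'M[R]_(m, n) :=
  a *: V + b *: (V *m V^T *m V) + c *: (V *m (V^T *m V) ^+ 2).

Definition quintic_ns m n (G : 'M[R]_(m, n)) (j : nat) : 'M[R]_(m, n) :=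
  iter j (@ns_step (15 / 8) (- (5 / 4)) (3 / 8) m n) ((frob_norm G)^-1 *: G).

Definition orth_error m n (V : 'M[R]_(m, n)) : R :=
  spectral_norm (V^T *m V - 1%:M).

(* The maxima below range over finite nonempty families of nonnegative
   numbers, so seeding them with 0 is harmless. *)
Definition max_orth_error m n K (G : 'I_K.+1 -> 'M[R]_(m, n)) (j : nat) : R :=
  \big[Num.max/0]_(k < K.+1) orth_error (quintic_ns (G k) j).

Definition max_polar_error m n K (G U : 'I_K.+1 -> 'M[R]_(m, n)) (T : nat) : R :=
  \big[Num.max/0]_(k < K.+1) spectral_norm (quintic_ns (G k) T - U k).

Definition max_rank m n K (G : 'I_K.+1 -> 'M[R]_(m, n)) : nat :=
  \max_(k < K.+1) \rank (G k).

End NewtonSchulz.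

Section Objective.
Context {R : realType} {m n : nat}.
Implicit Types f : 'M[R]_(m, n) -> \bar R.

(* The matrix representing the differential of [f] (where [f] is finite and
   differentiable) for the Frobenius inner product. *)
Definition grad f (X : 'M[R]_(m, n)) : 'M[R]_(m, n) :=
  \matrix_(i, j) 'd (fine \o f) X (delta_mx i j).

Definition lipschitz_smooth (L : R) f : Prop :=
  [/\ forall X, f X \is a fin_num,
      forall X, differentiable (fine \o f) X &
      forall X Y, frob_norm (grad f X - grad f Y) <= L * frob_norm (X - Y)].

Definition is_minimum f (fstar : R) : Prop :=
  (exists X, f X = fstar%:E) /\ (forall X, (fstar%:E <= f X)%E).

Definition polyak_lojasiewicz (mu : R) f (fstar : R) : Prop :=
  is_minimum f fstar /\
  forall X, ((2 * mu)%:E * (f X - fstar%:E) <= (frob_norm (grad f X) ^+ 2)%:E)%E.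

(* Iterations 0, ..., K of realized PolarGrad with T inner steps and constant
   step size [gamma]; only [X 0], ..., [X K.+1] matter. *)
Definition polar_grad_run f (K T : nat) (gamma : R)
    (X : nat -> 'M[R]_(m, n)) : Prop :=
  forall k, (k <= K)%N ->
    let G := grad f (X k) in
    let V := quintic_ns G T in
    X k.+1 = X k - (gamma * frob_inner V G) *: V.

End Objective.

(* Main.v *)
(* Neither a singular value decomposition nor the spectral theorem is needed for
   the rate. With D = I - V^T V, one quintic step reads
   V' = V (I + D/2 + 3 D^2/8) and I - V'^T V' = (40 D^3 + 15 D^4 + 9 D^5)/64,
   whose coefficients are nonnegative with sum 1; hence |D'|_S <= |D|_S^3 as soon
   as |D|_S <= 1, which holds initially because |V_0|_F = 1.
   The T-th iterate is V_0 h(D_0) where h - 1 has nonnegative coefficients, so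
   <V_T, V_0>_F >= |V_0|_F^2 = 1, i.e. <V_T, G>_F >= |G|_F; moreover
   |V_T|_F^2 = n - tr D_T <= n (1 + delta). The descent lemma with the given step
   size and the Polyak-Lojasiewicz inequality then yield the factor
   1 - 1/(r kappa (1 + delta)), and delta <= e0^(3^T) <= eta once T is large. *)

Require Import Defs.
From HB Require Import structures.
From mathcomp Require Import all_boot all_order all_algebra.
From mathcomp Require Import all_classical all_reals all_analysis.
From mathcomp Require Import ring lra.

Set Implicit Arguments.
Unset Strict Implicit.
Unset Printing Implicit Defensive.

Import Order.TTheory GRing.Theory Num.Theory.
Import numFieldNormedType.Exports.

Local Open Scope classical_set_scope.
Local Open Scope ring_scope.

(** * Euclidean geometry of the Frobenius inner product *)

Section Frobenius.
Context {R : realType}.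

Lemma frob_innerE m n (A B : 'M[R]_(m, n)) :
  frob_inner A B = \sum_i \sum_j A i j * B i j.
Proof.
rewrite /frob_inner /mxtrace exchange_big; apply: eq_bigr => j _.
by rewrite mxE; apply: eq_bigr => i _; rewrite mxE.
Qed.

Lemma frob_inner_colE n (x y : 'cV[R]_n) :
  frob_inner x y = \sum_i x i 0 * y i 0.
Proof. by rewrite frob_innerE; apply: eq_bigr => i _; rewrite big_ord1. Qed.

Lemma frob_innerC m n (A B : 'M[R]_(m, n)) : frob_inner A B = frob_inner B A.
Proof. by rewrite /frob_inner -mxtrace_tr trmx_mul trmxK. Qed.

Lemma frob_innerDr m n (A B C : 'M[R]_(m, n)) :
  frob_inner A (B + C) = frob_inner A B + frob_inner A C.
Proof. by rewrite /frob_inner mulmxDr mxtraceD. Qed.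

Lemma frob_innerZr m n (A B : 'M[R]_(m, n)) c :
  frob_inner A (c *: B) = c * frob_inner A B.
Proof. by rewrite /frob_inner -scalemxAr mxtraceZ. Qed.

Lemma frob_innerDl m n (A B C : 'M[R]_(m, n)) :
  frob_inner (B + C) A = frob_inner B A + frob_inner C A.
Proof. by rewrite frob_innerC frob_innerDr !(frob_innerC A). Qed.

Lemma frob_innerZl m n (A B : 'M[R]_(m, n)) c :
  frob_inner (c *: B) A = c * frob_inner B A.
Proof. by rewrite frob_innerC frob_innerZr (frob_innerC A). Qed.

Lemma frob_innerBl m n (A B C : 'M[R]_(m, n)) :
  frob_inner (B - C) A = frob_inner B A - frob_inner C A.
Proof. by rewrite frob_innerDl -scaleN1r frob_innerZl mulN1r. Qed.

Lemma frob_inner_mull m n p (A : 'M[R]_(m, n)) (x : 'M[R]_(n, p)) y :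
  frob_inner (A *m x) y = frob_inner x (A^T *m y).
Proof. by rewrite /frob_inner trmx_mul mulmxA. Qed.

Lemma frob_inner_ge0 m n (A : 'M[R]_(m, n)) : 0 <= frob_inner A A.
Proof.
by rewrite frob_innerE; do 2![apply: sumr_ge0 => ? _]; rewrite -expr2 sqr_ge0.
Qed.

Lemma frob_inner_eq0 m n (A : 'M[R]_(m, n)) : frob_inner A A = 0 -> A = 0.
Proof.
rewrite frob_innerE => /eqP; rewrite psumr_eq0; last first.
  by move=> i _; apply: sumr_ge0 => ? _; rewrite -expr2 sqr_ge0.
move=> /allP h; apply/matrixP => i j; rewrite mxE.
have := h i (mem_index_enum _); rewrite psumr_eq0; last first.
  by move=> ? _; rewrite -expr2 sqr_ge0.
by move=> /allP /(_ j (mem_index_enum _)); rewrite -expr2 sqrf_eq0 => /eqP.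
Qed.

Lemma frob_norm_ge0 m n (A : 'M[R]_(m, n)) : 0 <= frob_norm A.
Proof. exact: sqrtr_ge0. Qed.

Lemma frob_norm_sqr m n (A : 'M[R]_(m, n)) : frob_norm A ^+ 2 = frob_inner A A.
Proof. by rewrite sqr_sqrtr // frob_inner_ge0. Qed.

Lemma frob_norm_le m n p q (A : 'M[R]_(m, n)) (B : 'M[R]_(p, q)) :
  (frob_norm A <= frob_norm B) = (frob_inner A A <= frob_inner B B).
Proof. by rewrite ler_sqrt // frob_inner_ge0. Qed.

Lemma frob_norm0 m n : frob_norm (0 : 'M[R]_(m, n)) = 0.
Proof. by rewrite /frob_norm /frob_inner mulmx0 mxtrace0 sqrtr0. Qed.

Lemma frob_norm_gt0 m n (A : 'M[R]_(m, n)) : (0 < frob_norm A) = (A != 0).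
Proof.
rewrite lt_neqAle frob_norm_ge0 andbT eq_sym.
congr (~~ _); apply/eqP/eqP => [h|->]; last exact: frob_norm0.
by apply: frob_inner_eq0; rewrite -frob_norm_sqr h expr0n.
Qed.

Lemma frob_normZ m n (A : 'M[R]_(m, n)) c :
  frob_norm (c *: A) = `|c| * frob_norm A.
Proof.
by rewrite /frob_norm frob_innerZr frob_innerZl mulrA -expr2 sqrtrM ?sqr_ge0//
  sqrtr_sqr.
Qed.

Lemma frob_cauchy_sqr m n (A B : 'M[R]_(m, n)) :
  frob_inner A B ^+ 2 <= frob_inner A A * frob_inner B B.
Proof.
have [/frob_inner_eq0 ->|B0] := eqVneq (frob_inner B B) 0.
  by rewrite -(scale0r (0 : 'M[R]_(m, n))) !frob_innerZr !mul0r mulr0 expr0n.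
have Bp : 0 < frob_inner B B by rewrite lt_neqAle eq_sym B0 frob_inner_ge0.
(* Up to the factor [frob_inner B B], this is the part of [A] orthogonal to [B]; expanding its
   square gives [frob_inner B B] times the claimed difference. *)
have := frob_inner_ge0 (frob_inner B B *: A + (- frob_inner A B) *: B).
rewrite !(frob_innerDr, frob_innerDl, frob_innerZr, frob_innerZl).
rewrite (frob_innerC B A); nra.
Qed.

Lemma frob_cauchy m n (A B : 'M[R]_(m, n)) :
  frob_inner A B <= frob_norm A * frob_norm B.
Proof.
apply: le_trans (ler_norm _) _.
rewrite -(ler_pXn2r (ltn0Sn 1)) ?nnegrE ?mulr_ge0 ?frob_norm_ge0//.
by rewrite exprMn !frob_norm_sqr real_normK ?num_real ?frob_cauchy_sqr.
Qed.

Lemma frob_normD m n (A B : 'M[R]_(m, n)) :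
  frob_norm (A + B) <= frob_norm A + frob_norm B.
Proof.
rewrite -(ler_pXn2r (ltn0Sn 1)) ?nnegrE ?addr_ge0 ?frob_norm_ge0//.
rewrite sqrrD !frob_norm_sqr frob_innerDr !frob_innerDl (frob_innerC B A).
have := frob_cauchy A B; lra.
Qed.

Lemma frob_norm_tr m n (A : 'M[R]_(m, n)) : frob_norm A^T = frob_norm A.
Proof. by rewrite /frob_norm /frob_inner trmxK mxtrace_mulC. Qed.

Lemma frob_norm_mulmx m n p (A : 'M[R]_(m, n)) (B : 'M[R]_(n, p)) :
  frob_norm (A *m B) <= frob_norm A * frob_norm B.
Proof.
rewrite -(ler_pXn2r (ltn0Sn 1)) ?nnegrE ?mulr_ge0 ?frob_norm_ge0//.
rewrite exprMn !frob_norm_sqr !frob_innerE [X in _ * X]exchange_big/=.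
rewrite mulr_suml; apply: ler_sum => i _; rewrite mulr_sumr.
apply: ler_sum => j _; have := frob_cauchy_sqr (row i A)^T (col j B).
rewrite !frob_inner_colE -expr2 !mxE.
under [X in X ^+ 2 <= _]eq_bigr do rewrite !mxE.
under [X in _ <= X * _]eq_bigr do rewrite !mxE.
by under [X in _ <= _ * X]eq_bigr do rewrite !mxE.
Qed.

Lemma frob_norm_isometry m n p (P : 'M[R]_(m, n)) (x : 'M[R]_(n, p)) :
  P^T *m P = 1%:M -> frob_norm (P *m x) = frob_norm x.
Proof. by move=> h; rewrite /frob_norm frob_inner_mull mulmxA h mul1mx. Qed.

(** [Q *m Q^T] is an orthogonal projection, so the squared norm of [x - Q *m (Q^T *m x)] is the
    difference of the two squared norms. *)
Lemma frob_norm_coisometry m n p (Q : 'M[R]_(m, n)) (x : 'M[R]_(m, p)) :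
  Q^T *m Q = 1%:M -> frob_norm (Q^T *m x) <= frob_norm x.
Proof.
move=> h; set y := Q^T *m x; rewrite frob_norm_le.
have xy : frob_inner x (Q *m y) = frob_inner y y.
  by rewrite frob_innerC frob_inner_mull.
have yy : frob_inner (Q *m y) (Q *m y) = frob_inner y y.
  by rewrite frob_inner_mull mulmxA h mul1mx.
have := frob_inner_ge0 (x - Q *m y); rewrite -scaleN1r.
rewrite !(frob_innerDr, frob_innerDl, frob_innerZr, frob_innerZl).
rewrite (frob_innerC (Q *m y) x) xy yy. lra.
Qed.

End Frobenius.

(** * The spectral norm as an operator norm *)

Section SpectralNorm.
Context {R : realType}.

Lemma spectral_norm_le m n (A : 'M[R]_(m, n)) c :
  0 <= c -> (forall x : 'cV_n, frob_norm (A *m x) <= c * frob_norm x) ->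
  spectral_norm A <= c.
Proof.
move=> c0 h; apply: ge_sup.
  by exists (frob_norm (A *m (0 : 'cV_n))), 0 => //=; rewrite frob_norm0.
move=> _ [x /= x1 <-]; apply: le_trans (h x) _.
by rewrite -[leRHS]mulr1 ler_wpM2l.
Qed.

Lemma le_spectral_norm_unit m n (A : 'M[R]_(m, n)) (x : 'cV_n) :
  frob_norm x <= 1 -> frob_norm (A *m x) <= spectral_norm A.
Proof.
move=> x1; apply: ub_le_sup; last by exists x.
(* A supremum bounds its set only if the set is bounded above; the Frobenius norm provides such a
   bound. *)
exists (frob_norm A) => _ [y /= y1 <-].
apply: le_trans (frob_norm_mulmx _ _) _.
by rewrite -[leRHS]mulr1 ler_wpM2l// frob_norm_ge0.
Qed.

Lemma le_spectral_norm m n (A : 'M[R]_(m, n)) (x : 'cV_n) :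
  frob_norm (A *m x) <= spectral_norm A * frob_norm x.
Proof.
have [->|x0] := eqVneq x 0; first by rewrite mulmx0 !frob_norm0 mulr0.
have xp : 0 < frob_norm x by rewrite frob_norm_gt0.
have ix0 : 0 <= (frob_norm x)^-1 by rewrite invr_ge0 ltW.
rewrite -ler_pdivrMr// mulrC -[in X in X * _](ger0_norm ix0).
rewrite -frob_normZ scalemxAr.
apply: le_spectral_norm_unit.
by rewrite frob_normZ ger0_norm// mulVf ?gt_eqF.
Qed.

Lemma spectral_norm_ge0 m n (A : 'M[R]_(m, n)) : 0 <= spectral_norm A.
Proof.
apply: le_trans (frob_norm_ge0 (A *m (0 : 'cV_n))) _.
by apply: le_spectral_norm_unit; rewrite frob_norm0.
Qed.

Lemma spectral_normD m n (A B : 'M[R]_(m, n)) :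
  spectral_norm (A + B) <= spectral_norm A + spectral_norm B.
Proof.
apply: spectral_norm_le; first by rewrite addr_ge0 ?spectral_norm_ge0.
move=> x; rewrite mulmxDl mulrDl; apply: le_trans (frob_normD _ _) _.
by rewrite lerD ?le_spectral_norm.
Qed.

Lemma spectral_normZ_le m n (A : 'M[R]_(m, n)) c :
  spectral_norm (c *: A) <= `|c| * spectral_norm A.
Proof.
apply: spectral_norm_le => [|x]; first by rewrite mulr_ge0 ?spectral_norm_ge0.
by rewrite -scalemxAl frob_normZ -mulrA ler_wpM2l ?le_spectral_norm.
Qed.

Lemma spectral_normN m n (A : 'M[R]_(m, n)) :
  spectral_norm (- A) = spectral_norm A.
Proof.
rewrite /spectral_norm; congr sup; apply: eq_imagel => x _.
by rewrite mulNmx -scaleN1r frob_normZ normrN1 mul1r.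
Qed.

Lemma spectral_norm_mulmx m n p (A : 'M[R]_(m, n)) (B : 'M[R]_(n, p)) :
  spectral_norm (A *m B) <= spectral_norm A * spectral_norm B.
Proof.
apply: spectral_norm_le => [|x]; first by rewrite mulr_ge0 ?spectral_norm_ge0.
rewrite -mulmxA; apply: le_trans (le_spectral_norm _ _) _.
by rewrite -mulrA ler_wpM2l ?spectral_norm_ge0 ?le_spectral_norm.
Qed.

(** Each diagonal entry is the inner product of a unit vector [e] with [A *m e], so Cauchy-Schwarz
    bounds it by the spectral norm. *)
Lemma mxtrace_le_spectral_norm n (A : 'M[R]_n) :
  `|\tr A| <= n%:R * spectral_norm A.
Proof.
apply: le_trans (ler_norm_sum _ _ _) _.
rewrite -[X in X%:R]card_ord mulr_natl -sumr_const; apply: ler_sum => i _.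
pose e : 'cV[R]_n := delta_mx i 0.
have e1 : frob_norm e = 1.
  rewrite /frob_norm frob_inner_colE (bigD1 i)//= big1 ?addr0.
    by rewrite !mxE !eqxx mulr1 sqrtr1.
  by move=> j ji; rewrite !mxE (negbTE ji)/= mul0r.
have -> : A i i = frob_inner e (A *m e).
  rewrite frob_inner_colE (bigD1 i)//= big1 ?addr0.
    rewrite -colE !mxE !eqxx mul1r //.
  by move=> j ji; rewrite !mxE (negbTE ji)/= mul0r.
have Ae : frob_norm (A *m e) <= spectral_norm A.
  by rewrite -[leRHS]mulr1 -e1 le_spectral_norm.
apply: le_trans Ae; rewrite ler_norml lerNl -mulN1r -frob_innerZl.
rewrite !(le_trans (frob_cauchy _ _))// ?frob_normZ ?normrN1 e1 ?mul1r//.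
Qed.
End SpectralNorm.

(** * One quintic step in terms of the residual *)

Section QuinticStep.
Context {R : realType}.

Definition residual m n (V : 'M[R]_(m, n)) : 'M[R]_n := 1%:M - V^T *m V.

Lemma orth_errorE m n (V : 'M[R]_(m, n)) :
  orth_error V = spectral_norm (residual V).
Proof. by rewrite /orth_error -spectral_normN opprB. Qed.

Lemma residual_sym m n (V : 'M[R]_(m, n)) : (residual V)^T = residual V.
Proof. by rewrite /residual linearB/= trmx1 trmx_mul trmxK. Qed.

(** The degree 2 Taylor polynomial of (1 - x)^(-1/2), the factor that would orthogonalize exactly.
    An arbitrary algebra allows evaluation both at ['X] and at a matrix. *)
Definition ns_factor (A : algType R) (x : A) : A :=
  1 + (1 / 2) *: x + (3 / 8) *: x ^+ 2.

(** This is 1 - (1 - x) [ns_factor x]^2, where the Taylor property cancels all terms of degree below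
    3. *)
Definition ns_residual (A : algType R) (x : A) : A :=
  (5 / 8) *: x ^+ 3 + (15 / 64) *: x ^+ 4 + (9 / 64) *: x ^+ 5.

Lemma ns_factor_lrmorph (A B : algType R) (f : {lrmorphism A -> B}) (x : A) :
  f (ns_factor x) = ns_factor (f x).
Proof. by rewrite /ns_factor !rmorphD /= !linearZ /= rmorphXn rmorph1. Qed.

Lemma ns_residual_lrmorph (A B : algType R) (f : {lrmorphism A -> B}) (x : A) :
  f (ns_residual x) = ns_residual (f x).
Proof. by rewrite /ns_residual !rmorphD /= !linearZ /= !rmorphXn. Qed.

(** Scalars become multiples of the constant polynomial [(8^-1)%:P], so that [ring] works in
    [{poly R}] with [eight_inv] as the only extra relation. *)
Let scale8 (p : {poly R}) (c : nat) :
  (c%:R / 8) *: p = c%:R * (8^-1)%:P * p.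
Proof. by rewrite -mul_polyC polyCM rmorph_nat. Qed.

Let scale64 (p : {poly R}) (c : nat) :
  (c%:R / 64) *: p = c%:R * (8^-1)%:P ^+ 2 * p.
Proof.
have -> : 64^-1 = 8^-1 ^+ 2 :> R by field.
by rewrite -mul_polyC polyCM rmorph_nat rmorphXn.
Qed.

Let eight_inv : 8 * (8^-1)%:P = 1 :> {poly R}.
Proof. by rewrite -(rmorph_nat polyC 8) -polyCM mulfV// polyC1. Qed.

(** Here ['X] stands for the residual and [1 - 'X] for [V^T *m V]. *)
Lemma ns_factor_poly :
  (15 / 8) *: 1 + (- (5 / 4)) *: (1 - 'X) + (3 / 8) *: (1 - 'X) ^+ 2
    = ns_factor 'X :> {poly R}.
Proof.
rewrite /ns_factor.
have -> : - (5 / 4) = - (10 / 8) :> R by field.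
have -> : 1 / 2 = 4 / 8 :> R by field.
rewrite scaleNr !scale8; ring: eight_inv.
Qed.

Lemma ns_residual_poly :
  1 - ns_factor 'X * (1 - 'X) * ns_factor 'X = ns_residual 'X :> {poly R}.
Proof.
rewrite /ns_factor /ns_residual.
have -> : 1 / 2 = 4 / 8 :> R by field.
have -> : 5 / 8 = 40 / 64 :> R by field.
rewrite !scale8 !scale64.
have := eight_inv; move: (8^-1)%:P => h e.
have -> : 1 + 4%:R * h * 'X + 3%:R * h * 'X^2 = h * (8 + 4 * 'X + 3 * 'X^2).
  by rewrite -[X in X + _ + _ = _]e; ring.
have e2 : 64 * h ^+ 2 = 1.
  by rewrite -[RHS](expr1n _ 2) -[in RHS]e; ring.
by rewrite -[X in X - _]e2; ring.
Qed.

Variables m n : nat.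
Implicit Types V : 'M[R]_(m, n.+1).

Let step := @ns_step R (15 / 8) (- (5 / 4)) (3 / 8) m n.+1.

(* Evaluation at [D] as an opaque morphism: identities between polynomials in
   [D] are then checked in the commutative ring [{poly R}]. *)
Lemma horner_mx_lrmorph (D : 'M[R]_n.+1) :
  {f : {lrmorphism {poly R} -> 'M[R]_n.+1} | f =1 horner_mx D & f 'X = D}.
Proof. by exists (horner_mx D) => //; exact: horner_mx_X. Qed.

Lemma ns_stepE V : step V = V *m ns_factor (residual V).
Proof.
have [f _ fX] := horner_mx_lrmorph (residual V).
have MD : V^T *m V = f (1 - 'X) by rewrite rmorphB rmorph1 /= fX subKr.
rewrite -[in RHS]fX -ns_factor_lrmorph -ns_factor_poly.
have fZ c p : f (c *: p) = c *: f p by rewrite linearZ.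
rewrite !rmorphD /= !fZ rmorphXn rmorph1 /= -MD.
by rewrite !mulmxDr -!scalemxAr mulmx1 (mulmxA V V^T V).
Qed.

Lemma ns_factor_sym (D : 'M[R]_n.+1) : D^T = D -> (ns_factor D)^T = ns_factor D.
Proof.
by move=> h; rewrite /ns_factor expr2 !linearD /= !linearZ /= trmx1 trmx_mul h.
Qed.

Lemma residual_ns_step V : residual (step V) = ns_residual (residual V).
Proof.
rewrite {1}/residual ns_stepE trmx_mul ns_factor_sym ?residual_sym//.
have [f _ fX] := horner_mx_lrmorph (residual V).
have MD : V^T *m V = f (1 - 'X) by rewrite rmorphB rmorph1 /= fX subKr.
rewrite -fX -!ns_factor_lrmorph -ns_residual_lrmorph -ns_residual_poly.
have fM p q : f (p * q) = f p *m f q by rewrite rmorphM.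
have f1B p : f (1 - p) = 1%:M - f p by rewrite rmorphB rmorph1.
by rewrite -mulmxA (mulmxA V^T) MD mulmxA [RHS]f1B !fM.
Qed.

End QuinticStep.

(** * Cubic contraction of the residual in spectral norm *)

Section SpectralResidual.
Context {R : realType} {n : nat}.

Lemma spectral_normX (D : 'M[R]_n.+1) k :
  spectral_norm (D ^+ k.+1) <= spectral_norm D ^+ k.+1.
Proof.
elim: k => [|k IH]; first by rewrite !expr1.
rewrite exprS [leRHS]exprS; apply: le_trans (spectral_norm_mulmx _ _) _.
by rewrite ler_wpM2l ?spectral_norm_ge0.
Qed.

(** Every exponent in [ns_residual] is at least 3, so for norm at most 1 each power is dominated by
    the cube, and the coefficients sum to 1. *)
Lemma spectral_norm_ns_residual (D : 'M[R]_n.+1) :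
  spectral_norm D <= 1 -> spectral_norm (ns_residual D) <= spectral_norm D ^+ 3.
Proof.
move=> D1; have D0 := spectral_norm_ge0 D.
have term (c : R) k : 0 <= c ->
    spectral_norm (c *: D ^+ (3 + k)) <= c * spectral_norm D ^+ 3.
  move=> c0; apply: le_trans (spectral_normZ_le _ _) _.
  rewrite ger0_norm// ler_wpM2l//; apply: le_trans (spectral_normX _ _) _.
  by rewrite -[leLHS]/(spectral_norm D ^+ (3 + k)) exprD -[leRHS]mulr1
    ler_wpM2l ?exprn_ge0 ?exprn_ile1.
have t : spectral_norm (ns_residual D) <=
    5 / 8 * spectral_norm D ^+ 3 + 15 / 64 * spectral_norm D ^+ 3 +
    9 / 64 * spectral_norm D ^+ 3.
  apply: le_trans (spectral_normD _ _) _; apply: lerD; last first.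
    by apply: (term _ 2%N); rewrite divr_ge0.
  apply: le_trans (spectral_normD _ _) _; apply: lerD.
    by apply: (term _ 0%N); rewrite divr_ge0.
  by apply: (term _ 1%N); rewrite divr_ge0.
apply: le_trans t _; rewrite -!mulrDl.
have -> : 5 / 8 + 15 / 64 + 9 / 64 = 1 :> R by field.
by rewrite mul1r.
Qed.

End SpectralResidual.

(** * The iteration from a normalized matrix: error decay, correlation with the gradient, size and
    rank *)

Section QuinticIteration.
Context {R : realType}.

Lemma frob_norm_normalize m n (G : 'M[R]_(m, n)) :
  G != 0 -> frob_norm ((frob_norm G)^-1 *: G) = 1.
Proof.
rewrite -frob_norm_gt0 => G0.
by rewrite frob_normZ ger0_norm ?invr_ge0 ?(ltW G0)// mulVf ?gt_eqF.
Qed.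

Lemma frob_norm_mulmx_tr_unit m n p (V : 'M[R]_(m, n)) (Y : 'M[R]_(p, n)) :
  frob_norm V = 1 -> frob_inner (Y *m V^T) (Y *m V^T) <= frob_inner Y Y.
Proof.
move=> V1; rewrite -frob_norm_le; apply: le_trans (frob_norm_mulmx _ _) _.
by rewrite frob_norm_tr V1 mulr1.
Qed.

(** With [y = V *m x], the squared norm of [x - V^T *m y] is |x|^2 - 2 |y|^2 + |V^T y|^2, and |V^T
    y| <= |y|. *)
Lemma orth_error_le1 m n (V : 'M[R]_(m, n)) :
  frob_norm V = 1 -> orth_error V <= 1.
Proof.
move=> V1; rewrite orth_errorE; apply: spectral_norm_le => // x.
rewrite mul1r frob_norm_le /residual mulmxBl mul1mx -mulmxA.
set y := V *m x.
have xy : frob_inner x (V^T *m y) = frob_inner y y.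
  by rewrite -frob_inner_mull.
have yy : frob_inner (V^T *m y) (V^T *m y) <= frob_inner y y.
  rewrite -frob_norm_le; apply: le_trans (frob_norm_mulmx _ _) _.
  by rewrite frob_norm_tr V1 mul1r.
have y0 := frob_inner_ge0 y.
rewrite -[in leLHS]scaleN1r.
rewrite !(frob_innerDr, frob_innerDl, frob_innerZr, frob_innerZl).
rewrite (frob_innerC _ x) xy; lra.
Qed.

Variables m n : nat.
Implicit Types G V : 'M[R]_(m, n.+1).

Lemma residual_quintic_nsS G j :
  residual (quintic_ns G j.+1) = ns_residual (residual (quintic_ns G j)).
Proof. exact: residual_ns_step. Qed.

Lemma orth_error_quintic_ns G j : G != 0 ->
  orth_error (quintic_ns G j) <= orth_error (quintic_ns G 0) ^+ (3 ^ j)%N.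
Proof.
move=> G0; have e01 := orth_error_le1 (frob_norm_normalize G0).
elim: j => [|j IH]; first by rewrite expr1.
have e0 : 0 <= orth_error (quintic_ns G 0) by exact: spectral_norm_ge0.
rewrite orth_errorE residual_quintic_nsS.
apply: le_trans (spectral_norm_ns_residual _) _; rewrite -orth_errorE.
  by apply: le_trans IH _; rewrite exprn_ile1.
rewrite expnSr exprM lerXn2r ?nnegrE ?exprn_ge0//; exact: spectral_norm_ge0.
Qed.

(** Nonnegativity is tracked for [h - 1] rather than [h], since the summand 1 is what reproduces the
    initial iterate in the correlation bound. *)
Lemma quintic_ns_poly G : let D := residual (quintic_ns G 0) in
  forall j, exists h d : {poly R},
  [/\ h - 1 \is a polyOver Num.nneg, d \is a polyOver Num.nneg,
      quintic_ns G j = quintic_ns G 0 *m horner_mx D h &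
      residual (quintic_ns G j) = horner_mx D d].
Proof.
move=> D; have [f fE fX] := horner_mx_lrmorph D.
elim=> [|j [h [d [h1 d0 Vj Dj]]]].
  exists 1, 'X; split.
  - by rewrite subrr polyOver0.
  - exact: polyOverX.
  - by rewrite -fE rmorph1 mulmx1.
  - by rewrite -fE fX.
pose nn := fun p : {poly R} => p \is a polyOver Num.nneg.
have nnD p q : nn p -> nn q -> nn (p + q).
  exact: (polyOver_addr_closed _).2.
have nnM p q : nn p -> nn q -> nn (p * q) by exact: polyOver_mulr_2closed.
have nnX p i : nn p -> nn (p ^+ i).
  move=> p0; elim: i => [|i IH]; first exact: polyOver_mul1_closed.
  by rewrite exprS; exact: nnM.
have nnZ (a b : nat) p : nn p -> nn ((a%:R / b%:R) *: p).
  by move=> p0; apply: polyOverZ => //; rewrite nnegrE divr_ge0.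
have nf : ns_factor d - 1 \is a polyOver Num.nneg.
  have -> : ns_factor d - 1 = (1 / 2) *: d + (3 / 8) *: d ^+ 2.
    by rewrite /ns_factor; ring.
  exact: (nnD _ _ (nnZ 1%N 2%N _ d0) (nnZ 3%N 8%N _ (nnX _ 2%N d0))).
exists (h * ns_factor d), (ns_residual d); split.
(* Writing both factors as 1 plus a nonnegative polynomial makes every term of the product minus 1
   nonnegative. *)
- have -> : h * ns_factor d - 1 =
      (h - 1) * (ns_factor d - 1) + (h - 1) + (ns_factor d - 1) by ring.
  exact: (nnD _ _ (nnD _ _ (nnM _ _ h1 nf) h1) nf).
- rewrite /ns_residual;
  exact: (nnD _ _ (nnD _ _ (nnZ 5%N 8%N _ (nnX _ 3%N d0))
    (nnZ 15%N 64%N _ (nnX _ 4%N d0))) (nnZ 9%N 64%N _ (nnX _ 5%N d0))).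
- rewrite {1}/quintic_ns iterS -/(quintic_ns G j) ns_stepE Dj Vj -mulmxA.
  by rewrite -!fE rmorphM /= ns_factor_lrmorph.
- by rewrite residual_quintic_nsS Dj -!fE ns_residual_lrmorph.
Qed.

(* For [k = 2i] the value is [|V D^i|^2]; for [k = 2i + 1] it is
   [|Y|^2 - |Y V^T|^2] with [Y = V D^i], and [|V| = 1]. *)
Lemma residual_power_correlation V k : frob_norm V = 1 ->
  0 <= frob_inner (V *m residual V ^+ k) V.
Proof.
move=> V1; set D := residual V.
have mulD (X Y : 'M[R]_(m, n.+1)) :
    frob_inner (X *m D) Y = frob_inner X (Y *m D).
  by rewrite /frob_inner trmx_mul residual_sym -mulmxA mxtrace_mulC -mulmxA.
have step i (X Y : 'M[R]_(m, n.+1)) :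
    frob_inner (X *m D ^+ i) Y = frob_inner X (Y *m D ^+ i).
  elim: i X Y => [|i IH] X Y; first by rewrite expr0 !mulmx1.
  by rewrite exprS mulmxA IH mulD -mulmxA -exprS exprSr.
have -> : k = (k./2 + (odd k + k./2))%N.
  by rewrite addnCA addnn odd_double_half.
rewrite exprD mulmxA step; set Y := V *m D ^+ k./2.
rewrite addnC exprD mulmxA -/Y.
have Y0 := frob_inner_ge0 Y.
case: odd; last by rewrite expr0 mulmx1.
rewrite expr1 /D /residual mulmxBr mulmx1 frob_innerC frob_innerBl subr_ge0.
rewrite mulmxA; have := frob_norm_mulmx_tr_unit Y V1.
suff -> : frob_inner (Y *m V^T) (Y *m V^T) = frob_inner (Y *m V^T *m V) Y by [].
by rewrite /frob_inner !trmx_mul trmxK mulmxA mxtrace_mulC !mulmxA.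
Qed.

Lemma residual_poly_correlation V (p : {poly R}) :
  frob_norm V = 1 -> p \is a polyOver Num.nneg ->
  0 <= frob_inner (V *m horner_mx (residual V) p) V.
Proof.
move=> V1 /polyOverP p0; have [f fE fX] := horner_mx_lrmorph (residual V).
rewrite -fE -[p]coefK poly_def raddf_sum mulmx_sumr.
have -> I (r : seq I) (F : I -> 'M[R]_(m, n.+1)) :
    frob_inner (\sum_(i <- r) F i) V = \sum_(i <- r) frob_inner (F i) V.
  elim/big_ind2: _ => [|? ? ? ? <- <-|//]; last by rewrite frob_innerDl.
  by rewrite /frob_inner trmx0 mul0mx mxtrace0.
apply: sumr_ge0 => i _.
rewrite /= linearZ /= rmorphXn /= fX -scalemxAr frob_innerZl.
by rewrite mulr_ge0 ?residual_power_correlation// -nnegrE p0.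
Qed.

(** The summand 1 of [h] contributes |V_0|_F^2 = 1 and [h - 1] contributes a nonnegative amount;
    multiplying by [frob_norm G] turns V_0 back into [G]. *)
Lemma quintic_ns_correlation G T : G != 0 ->
  frob_norm G <= frob_inner (quintic_ns G T) G.
Proof.
move=> G0; have V1 := frob_norm_normalize G0.
rewrite -[(frob_norm G)^-1 *: G]/(quintic_ns G 0) in V1.
have [h [d [h1 _ -> _]]] := quintic_ns_poly G T.
have Gp : 0 < frob_norm G by rewrite frob_norm_gt0.
have [f fE _] := horner_mx_lrmorph (residual (quintic_ns G 0)).
have GE : G = frob_norm G *: quintic_ns G 0.
  by rewrite /quintic_ns /= scalerA mulfV ?gt_eqF ?scale1r.
rewrite [X in frob_inner _ X]GE frob_innerZr -[leLHS]mulr1.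
rewrite ler_wpM2l ?(ltW Gp)//.
rewrite -[h](subrK 1) -fE rmorphD rmorph1 mulmxDr mulmx1 frob_innerDl.
by rewrite -frob_norm_sqr V1 expr1n lerDr /= fE residual_poly_correlation.
Qed.

Lemma quintic_ns_frob_sqr G T :
  frob_inner (quintic_ns G T) (quintic_ns G T)
    <= n.+1%:R * (1 + orth_error (quintic_ns G T)).
Proof.
set V := quintic_ns G T.
have -> : frob_inner V V = n.+1%:R - \tr (residual V).
  by rewrite /residual linearB /= mxtrace1 subKr.
rewrite orth_errorE mulrDr mulr1 lerD2l.
apply: le_trans (mxtrace_le_spectral_norm _).
by rewrite -normrN ler_norm.
Qed.

(** A nonzero vector killed by [G] is fixed by the initial residual, which forces the error to be at
    least 1. This turns e0 < 1 into full column rank, so the trace bound by the number of columns is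
    a bound by the rank. *)
Lemma rank_orth_error_lt1 G :
  orth_error (quintic_ns G 0) < 1 -> \rank G = n.+1.
Proof.
move=> e1; rewrite -mxrank_tr; apply/eqP; rewrite -/(row_free _) -kermx_eq0.
apply/eqP/row_matrixP => i; rewrite row0.
set x := row i _; have xG : x *m G^T = 0.
  by rewrite /x -row_mul mulmx_ker row0.
apply: trmx_inj; rewrite trmx0; apply/eqP; apply: contraTT e1.
rewrite -frob_norm_gt0 -leNgt => x0; rewrite orth_errorE -(ler_pM2r x0) mul1r.
apply: le_trans (le_spectral_norm _ _).
rewrite /residual mulmxBl mul1mx -mulmxA /quintic_ns /= -scalemxAl.
by rewrite -(trmxK G) -trmx_mul xG trmx0 scaler0 mulmx0 subr0.
Qed.

End QuinticIteration.

(** * Distance to the polar factor, read on singular values *)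

Section PolarError.
Context {R : realType}.

Lemma frob_norm_diag_le r (w : 'rV[R]_r) (y : 'cV[R]_r) :
  (forall i, 0 <= w 0 i <= 1) -> frob_norm (diag_mx w *m y) <= frob_norm y.
Proof.
move=> w01; rewrite frob_norm_le !frob_inner_colE; apply: ler_sum => i _.
rewrite mul_diag_mx !mxE; have /andP[w0 w1] := w01 i.
rewrite mulrACA -!expr2 -[leRHS]mul1r ler_wpM2r ?sqr_ge0//.
by rewrite exprn_ile1.
Qed.

(** A step keeps the singular vectors and applies an odd polynomial to the singular values, so the
    polar factor stays [P *m Q^T] along the iteration. *)
Lemma ns_step_svd m n r (P : 'M[R]_(m, r)) (Q : 'M[R]_(n, r))
    (t : 'rV[R]_r) a b c :
  P^T *m P = 1%:M -> Q^T *m Q = 1%:M ->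
  ns_step a b c (P *m diag_mx t *m Q^T) =
  P *m diag_mx (\row_i (a * t 0 i + b * t 0 i ^+ 3 + c * t 0 i ^+ 5)) *m Q^T.
Proof.
move=> PP QQ; set D := diag_mx t; set V := P *m D *m Q^T.
have VT : V^T = Q *m D *m P^T by rewrite /V !trmx_mul trmxK tr_diag_mx mulmxA.
have VV : V^T *m V = Q *m (D *m D) *m Q^T.
  by rewrite VT /V -!mulmxA (mulmxA P^T P) PP mul1mx !mulmxA.
have mulV (E F : 'M[R]_r) :
    (P *m E *m Q^T) *m (Q *m F *m Q^T) = P *m (E *m F) *m Q^T.
  by rewrite -!mulmxA (mulmxA Q^T Q) QQ mul1mx !mulmxA.
rewrite /ns_step -mulmxA VV; set W := Q *m _ *m _.
have -> : V *m W ^+ 2 = V *m W *m W by rewrite expr2 -mulmxA.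
rewrite /V /W !mulV.
have scale e (E : 'M[R]_r) : e *: (P *m E *m Q^T) = P *m (e *: E) *m Q^T.
  by rewrite -scalemxAr -scalemxAl.
rewrite !scale -!mulmxDl -!mulmxDr; congr (_ *m _ *m _).
rewrite /D !mulmx_diag -!linearZ -!linearD /=; congr diag_mx.
by apply/rowP => i; rewrite !mxE; ring.
Qed.

Lemma quintic_ns_svd m n (G U : 'M[R]_(m, n)) j :
  G != 0 -> is_polar_factor G U ->
  exists r (P : 'M[R]_(m, r)) (t : 'rV[R]_r) (Q : 'M[R]_(n, r)),
    [/\ P^T *m P = 1%:M, Q^T *m Q = 1%:M, (forall i, 0 <= t 0 i),
        quintic_ns G j = P *m diag_mx t *m Q^T & U = P *m Q^T].
Proof.
rewrite -frob_norm_gt0 => G0 [P [s [Q [PP QQ s0 GE UE]]]].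
exists (\rank G), P.
suff [t t0 tE] : exists2 t : 'rV[R]_(\rank G),
    forall i, 0 <= t 0 i & quintic_ns G j = P *m diag_mx t *m Q^T.
  by exists t, Q.
elim: j => [|j [t t0 tE]].
  exists ((frob_norm G)^-1 *: s).
    by move=> i; rewrite mxE mulr_ge0 ?invr_ge0 ?ltW.
  by rewrite /quintic_ns /= linearZ /= -scalemxAr -scalemxAl -GE.
rewrite /quintic_ns iterS -/(quintic_ns G j) tE ns_step_svd//.
eexists; last by [].
move=> i; rewrite mxE; have := t0 i; move: (t 0 i) => x x0.
(* Completing the square in [x ^+ 2] shows that the step preserves nonnegativity of the singular
   values. *)
have -> : 15 / 8 * x + - (5 / 4) * x ^+ 3 + 3 / 8 * x ^+ 5 =
  x * (3 / 8 * (x ^+ 2 - 5 / 3) ^+ 2 + 5 / 6) by field.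
by rewrite mulr_ge0// addr_ge0 ?divr_ge0// mulr_ge0 ?divr_ge0 ?sqr_ge0.
Qed.

(* On each singular direction [1 - t = (1 + t)^-1 (1 - t^2)] with [t >= 0], so
   the polar error factors through the orthogonality residual. *)
Lemma polar_error_le_orth_error m n (G U : 'M[R]_(m, n)) j :
  G != 0 -> is_polar_factor G U ->
  spectral_norm (quintic_ns G j - U) <= orth_error (quintic_ns G j).
Proof.
move=> G0 /(quintic_ns_svd j G0) [r [P [t [Q [PP QQ t0 -> ->]]]]].
set V := P *m _ *m _; rewrite orth_errorE -opprB spectral_normN.
apply: spectral_norm_le => [|x]; first exact: spectral_norm_ge0.
pose w : 'rV[R]_r := \row_i (1 + t 0 i)^-1.
have -> : P *m Q^T - V = P *m diag_mx w *m Q^T *m residual V.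
  rewrite /residual -mulmxA mulmxBr mulmx1 /V !trmx_mul trmxK tr_diag_mx.
  have -> : Q^T *m (Q *m (diag_mx t *m P^T) *m (P *m diag_mx t *m Q^T)) =
      diag_mx t *m diag_mx t *m Q^T.
    by rewrite -!mulmxA (mulmxA Q^T Q) QQ mul1mx (mulmxA P^T P) PP mul1mx.
  have -> : P *m Q^T - P *m diag_mx t *m Q^T = P *m (1%:M - diag_mx t) *m Q^T.
    by rewrite mulmxBr mulmx1 mulmxBl.
  have -> : Q^T - diag_mx t *m diag_mx t *m Q^T =
      (1%:M - diag_mx t *m diag_mx t) *m Q^T by rewrite mulmxBl mul1mx.
  rewrite mulmxA; congr (_ *m _); rewrite -mulmxA; congr (_ *m _).
  rewrite !mulmx_diag -[1%:M](@diag_const_mx _ r 1) -!linearB /= mulmx_diag.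
  congr diag_mx; apply/rowP => i; rewrite !mxE.
  by have := t0 i => ?; field; rewrite gt_eqF// ltr_wpDr.
(* The prefactor is a contraction: [P] is an isometry, the entries of [w] lie in [0, 1], and [Q^T]
   does not increase norms. *)
rewrite -mulmxA; apply: le_trans (le_spectral_norm _ _).
rewrite -!mulmxA frob_norm_isometry//.
apply: le_trans (frob_norm_diag_le _ _) (frob_norm_coisometry _ QQ).
move=> i; rewrite mxE; have ti : 1 <= 1 + t 0 i by rewrite lerDl.
by rewrite invr_ge0 invf_le1 ?(lt_le_trans ltr01 ti)// ti (le_trans ler01 ti).
Qed.
End PolarError.

(** * Uniform bounds over the family of gradients *)

Section MaxErrors.
Context {R : realType} (m n K : nat).
Implicit Types G U : 'I_K.+1 -> 'M[R]_(m, n.+1).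

Lemma max_orth_error_le G T : (forall k, G k != 0) ->
  max_orth_error G T <= max_orth_error G 0 ^+ (3 ^ T)%N.
Proof.
move=> G0; have e0 : 0 <= max_orth_error G 0.
  by apply: le_trans (le_bigmax _ _ ord0); exact: spectral_norm_ge0.
apply: bigmax_le => [|k _]; first exact: exprn_ge0.
apply: le_trans (orth_error_quintic_ns T (G0 k)) _.
by rewrite lerXn2r ?nnegrE ?spectral_norm_ge0//; exact: le_bigmax.
Qed.

Lemma max_polar_error_le G U T : (forall k, G k != 0) ->
  (forall k, is_polar_factor (G k) (U k)) ->
  max_polar_error G U T <= max_orth_error G T.
Proof.
move=> G0 GU; apply: le_bigmax2 => k _; exact: polar_error_le_orth_error.
Qed.
End MaxErrors.

(** * The descent lemma for Lipschitz gradients *)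

Section Descent.
Context {R : realType} {m n : nat}.
Implicit Types f : 'M[R]_(m, n) -> \bar R.

Lemma diff_grad f (X D : 'M[R]_(m, n)) :
  'd (fine \o f) X D = frob_inner (grad f X) D.
Proof.
rewrite {1}(matrix_sum_delta D) linear_sum frob_innerE; apply: eq_bigr => i _.
rewrite linear_sum; apply: eq_bigr => j _.
by rewrite linearZ /= mxE mulrC.
Qed.

Lemma is_derive_line f (X D : 'M[R]_(m, n)) (t : R) :
  differentiable (fine \o f) (X + t *: D) ->
  is_derive t 1 (fun s : R => fine (f (X + s *: D)))
    (frob_inner (grad f (X + t *: D)) D).
Proof.
move=> df; pose g (s : R) := fine (f (X + s *: D)).
(* The difference quotient of [g] at [t] is literally the one of [f] at [X + t *: D] in direction
   [D]. *)
have E : (fun h : R => h^-1 *: ((g \o shift t) (h *: 1) - g t)) =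
    (fun h : R => h^-1 *: (((fine \o f) \o shift (X + t *: D)) (h *: D)
                             - (fine \o f) (X + t *: D))).
  apply/funext => h /=; congr (_ *: (fine (f _) - _)).
  by rewrite scalerDl [h *: 1]mulr1 addrCA addrA.
rewrite -/g; split; first by rewrite /derivable E; exact: diff_derivable.
by rewrite /derive E -/(derive _ _ _) deriveE// diff_grad.
Qed.

Lemma smooth_descent f L (X D : 'M[R]_(m, n)) : lipschitz_smooth L f ->
  fine (f (X + D)) <=
    fine (f X) + frob_inner (grad f X) D + L / 2 * frob_inner D D.
Proof.
have arith (u a b v w t : R) : u - a <= 2 * t * b ->
    v - (a * 1 + b * 1 ^+ 2) - (w - (a * 0 + b * 0 ^+ 2)) =
      (u - (a + b * (2 * t))) * (1 - 0) ->
    v <= w + a + b by lra.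
move=> [_ df lipf].
pose c := frob_inner (grad f X) D; pose d := L / 2 * frob_inner D D.
pose g (t : R) := fine (f (X + t *: D)).
(* The mean value theorem for [h] on [0, 1] replaces integration: [d] is chosen so that 2 t d is the
   Lipschitz bound on the variation of the slope, whence h' <= 0 and h(1) <= h(0). *)
pose h (t : R) := g t - (c * t + d * t ^+ 2).
have dh (t : R) : is_derive t (1 : R) h
    (frob_inner (grad f (X + t *: D)) D - (c + d * (2 * t))).
  have gD : is_derive t (1 : R) g (frob_inner (grad f (X + t *: D)) D).
    exact: is_derive_line.
  have -> : h = g - (c \*: (@id R) + d \*: ((@id R) ^+ 2)).
    by apply/funext => s; rewrite /h !fctE.
  apply: is_derive_eq; congr (_ - (_ + _)); first exact: mulr1.
  by congr (d * _); exact: mulr1.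
have ch : {within `[0, 1], continuous h}.
  apply: derivable_within_continuous => t _.
  exact: (@ex_derive _ _ _ _ _ _ _ (dh t)).
have [t] := MVT ltr01 (fun t _ => dh t) ch.
rewrite in_itv /= => /andP[t0 t1].
have gradD : frob_inner (grad f (X + t *: D)) D - c <= 2 * t * d.
  rewrite /c -frob_innerBl; apply: le_trans (frob_cauchy _ _) _.
  have E : X + t *: D - X = t *: D by rewrite addrC addKr.
  have := lipf (X + t *: D) X; rewrite {}E frob_normZ.
  rewrite (gtr0_norm t0) => /(ler_wpM2r (frob_norm_ge0 D)) /le_trans; apply.
  by rewrite /d -frob_norm_sqr le_eqVlt; apply/orP; left; apply/eqP; field.
rewrite /h /g scale1r scale0r addr0 => E.
exact: (arith _ _ _ _ _ _ gradD E).
Qed.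
End Descent.

(** * From inner accuracy to the convergence rate *)

Section Rate.
Context {R : realType}.

(* With [y = ln eta / ln e0] one has [e0 ^ y = eta], and [3 ^ T >= y] because
   [exp (1/2) <= 3]. *)
Lemma exponent_ge_tolerance (e0 eta : R) (T : nat) :
  0 < e0 -> e0 < 1 -> 0 < eta -> eta <= e0 ->
  Num.ceil (2 * ln (ln eta / ln e0)) <= T%:Z -> e0 ^+ (3 ^ T)%N <= eta.
Proof.
move=> e0_gt0 e0_lt1 eta0 etae; rewrite ceil_le_int => Tge.
have lne0 : ln e0 < 0 by rewrite ln_lt0// e0_gt0.
have lneta : ln eta <= ln e0 by rewrite ler_ln ?posrE.
have y0 : 0 < ln eta / ln e0.
  by rewrite nmulr_rgt0 ?invr_lt0// (le_lt_trans lneta).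
rewrite -ler_ln ?posrE ?exprn_gt0// lnXn// -mulr_natl -ler_ndivrMr//.
(* Inverting reduces this to exp(-1/2) >= 1 - 1/2. *)
have half : expR (1 / 2 : R) <= 2.
  rewrite -[leRHS]invrK -[leLHS]invrK -expRN.
  rewrite lef_pV2 ?posrE ?expR_gt0 ?invr_gt0//.
  apply: le_trans (expR_ge1Dx _); lra.
have -> : ln eta / ln e0 = expR (ln (ln eta / ln e0)) by rewrite lnK ?posrE.
apply: (@le_trans _ _ (expR (T%:R * (1 / 2)))).
  rewrite ler_expR; move: Tge; rewrite -[T%:Z%:~R]/(T%:R : R); lra.
rewrite expRM_natl natrX lerXn2r ?nnegrE ?expR_ge0//.
by apply: le_trans half _; rewrite ler_nat.
Qed.

(** After cancelling mu / (L r) this is (1 - eta)(1 + delta) <= 1, which holds as 0 <= delta <=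
    eta. *)
Lemma rate_le (L mu r delta eta : R) :
  0 < L -> 0 < mu -> 0 < r -> 0 <= delta -> delta <= eta ->
  (1 - eta) / (r * (L / mu)) <= 1 / (L * r * (1 + delta)) * mu.
Proof.
move=> L0 mu0 r0 d0 de; have d1 : 0 < 1 + delta by rewrite ltr_pwDl.
have -> : (1 - eta) / (r * (L / mu)) = (1 - eta) * (mu / (L * r)).
  by field; rewrite !gt_eqF.
have -> : 1 / (L * r * (1 + delta)) * mu = (1 + delta)^-1 * (mu / (L * r)).
  by field; rewrite !gt_eqF.
rewrite ler_wpM2r ?divr_ge0 ?mulr_ge0 ?(ltW L0) ?(ltW mu0) ?(ltW r0)//.
rewrite -[leRHS]mul1r ler_pdivlMr//; nra.
Qed.

(** Stated for any [r] at least the number of columns and any [delta] dominating the current error,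
    so that maxima over the run can be inserted. *)
Lemma polar_grad_step m n (f : 'M[R]_(m, n.+1) -> \bar R)
    (fstar L mu r delta eta : R) (T : nat) (X Y : 'M[R]_(m, n.+1)) :
  let G := grad f X in let V := quintic_ns G T in
  0 < L -> 0 < mu -> lipschitz_smooth L f -> polyak_lojasiewicz mu f fstar ->
  G != 0 -> n.+1%:R <= r -> orth_error V <= delta -> delta <= eta ->
  Y = X - (1 / (L * r * (1 + delta)) * frob_inner V G) *: V ->
  (f Y - fstar%:E <=
    (1 - (1 - eta) / (r * (L / mu)))%:E * (f X - fstar%:E))%E.
Proof.
move=> G V L0 mu0 lipf [[_ fge] pl] G0 nr eV de ->.
have [ffin _ _] := lipf.
have d0 : 0 <= delta by apply: le_trans eV; exact: spectral_norm_ge0.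
have r0 : 0 < r by apply: lt_le_trans nr; rewrite ltr0n.
have d1 : 0 < 1 + delta by rewrite ltr_pwDl.
set gamma := 1 / _; have g0 : 0 < gamma by rewrite divr_gt0// !mulr_gt0.
have rate : (1 - eta) / (r * (L / mu)) <= gamma * mu by exact: rate_le.
set c := (1 - eta) / _ in rate *.
set nu := frob_inner V G.
have nuG : frob_inner G G <= nu ^+ 2.
  by rewrite -frob_norm_sqr lerXn2r ?nnegrE ?frob_norm_ge0//
    ?(le_trans (frob_norm_ge0 G)) ?quintic_ns_correlation.
(* With this, the quadratic term of the descent lemma costs at most half of the linear gain
   [gamma * nu ^+ 2]. *)
have VV : L * gamma * frob_inner V V <= 1.
  have g1 : L * gamma * (r * (1 + delta)) = 1.
    by rewrite /gamma; field; rewrite !gt_eqF.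
  have Lg0 : 0 <= L * gamma by apply: mulr_ge0; exact: ltW.
  rewrite -[leRHS]g1 ler_wpM2l//; apply: le_trans (quintic_ns_frob_sqr _ _) _.
  by rewrite ler_pM// ?lerD2l// addr_ge0 ?spectral_norm_ge0.
have := smooth_descent X (- (gamma * nu) *: V) lipf.
rewrite frob_innerZl !frob_innerZr (frob_innerC _ V) -/G -/nu scaleNr.
move: (pl X) (fge X); rewrite frob_norm_sqr -/G.
rewrite -(fineK (ffin X)) -(fineK (ffin (X - _))).
move: (fine (f (X - _))) (fine (f X)) => F' F.
rewrite /= -!EFinB -!EFinM !lee_fin => plF Fge F'le.
move: (frob_inner V V) (frob_inner G G) VV nuG plF F'le => v g VV nuG plF F'le.
have gnu : gamma * (2 * mu * (F - fstar)) <= gamma * nu ^+ 2.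
  by rewrite ler_wpM2l ?(ltW g0)// (le_trans plF).
have gv : (L * gamma * v) * (gamma * nu ^+ 2) <= 1 * (gamma * nu ^+ 2).
  by rewrite ler_wpM2r// mulr_ge0 ?sqr_ge0 ?(ltW g0).
have cF : c * (F - fstar) <= gamma * mu * (F - fstar).
  by rewrite ler_wpM2r// subr_ge0.
move: c gamma nu cF gv gnu F'le {rate VV nuG plF g0}.
move=> c gamma nu cF gv gnu F'le.
(* The chain is F' - F <= - gamma nu^2 / 2 <= - gamma mu (F - fstar) <= - c (F - fstar). *)
nra.
Qed.
End Rate.

Theorem theorem3p8 (R : realType) (m n K : nat) (hnm : (n <= m)%N)
    (hn : (1 <= n)%N) :
  (forall G U : 'I_K.+1 -> 'M[R]_(m, n),
     (forall k, G k != 0) ->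
     (forall k, is_polar_factor (G k) (U k)) ->
     exists Ceps Cdelta : R,
       [/\ 0 < Ceps, 0 < Cdelta &
           forall T : nat,
             max_polar_error G U T <= Ceps * max_orth_error G 0 ^+ (3 ^ T)%N /\
             max_orth_error G T <= Cdelta * max_orth_error G 0 ^+ (3 ^ T)%N])
  /\
  (forall (f : 'M[R]_(m, n) -> \bar R) (fstar L mu : R),
     0 < L -> 0 < mu ->
     lipschitz_smooth L f ->
     polyak_lojasiewicz mu f fstar ->
     forall e0 : R, 0 < e0 -> e0 < 1 ->
     exists C eta0 : R,
       [/\ 0 < C, 0 < eta0, eta0 < 1 &
           forall (eta : R) (T : nat),
             0 < eta -> eta <= eta0 ->
             Num.ceil (C * ln (ln eta / ln e0)) <= T%:Z ->
             forall X : nat -> 'M[R]_(m, n),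
               let G := fun k : 'I_K.+1 => grad f (X k) in
               let rmax : R := (max_rank G)%:R in
               let gamma := 1 / (L * rmax * (1 + max_orth_error G T)) in
               let kappa := L / mu in
               (forall k, G k != 0) ->
               polar_grad_run f K T gamma X ->
               max_orth_error G 0 = e0 ->
               forall k, (k <= K)%N ->
                 (f (X k.+1) - fstar%:E <=
                  (1 - (1 - eta) / (rmax * kappa))%:E *
                  (f (X k) - fstar%:E))%E]).
Proof.
(* The successor form of the column count makes square matrices of that size a ring, as polynomial
   evaluation requires. *)
case: n hn hnm => // n _ _; split => [G U G0 GU|].
  exists 1, 1; split => // T; rewrite !mul1r; split.
    exact: le_trans (max_polar_error_le _ G0 GU) (max_orth_error_le _ G0).
  exact: max_orth_error_le.
move=> f fstar L mu L0 mu0 lipf plf e0 e0_gt0 e0_lt1.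
(* The constant 2 matches exp(1/2) <= 3; taking [eta0 = e0] makes ln eta / ln e0 at least 1, so its
   logarithm is meaningful. *)
exists 2, e0; split => // eta T eta0 etae0 hT X G rmax gamma kappa.
move=> G0 run Ge0 k kK.
have kE : k = (Ordinal (n:=K.+1) kK : nat) by [].
have Gk0 : grad f (X k) != 0 by rewrite kE; exact: G0.
apply: (polar_grad_step L0 mu0 lipf plf Gk0 _ _ _ (run k kK)).
(* The first gradient already has full column rank because its initial error is at most e0 < 1, so
   [rmax] is at least the number of columns. *)
- rewrite ler_nat; apply: leq_trans (leq_bigmax ord0).
  rewrite (@rank_orth_error_lt1 _ _ _ (G ord0))//.
  by apply: le_lt_trans e0_lt1; rewrite -Ge0; exact: le_bigmax.
- rewrite kE; exact: (le_bigmax 0 (fun k => orth_error (quintic_ns (G k) T))).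
- apply: le_trans (max_orth_error_le T G0) _; rewrite Ge0.
  exact: exponent_ge_tolerance.
Qed.
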